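(* Let $m,\ell$ be positive integers, and let $p,q$ be integers with $p\neq 0$. Any two $(p,q)$-periodic elements in $G(m,\ell)$ are conjugate in $G(m,\ell)$.
   Context: For positive integers $m,\ell$, consider letters $a_0,\ldots,a_{m-1}$, and set $a_j:=a_{j'}$ for $j\in\mathbb{Z}$, where $j'\in\{0,\ldots,m-1\}$ and $j\equiv j' \pmod m$. For $i\in\mathbb{Z}$ and $p\geq 1$ let $s(i,p)=a_ia_{i+1}\cdots a_{i+p-1}$ (a product of $p$ consecutive letters). The circular group $G(m,\ell)$ is the group with generators $a_0,\ldots,a_{m-1}$ and relations $s(i,\ell)=s(i+1,\ell)$ for all $i\in\{0,\ldots,m-1\}$. The Garside element is $\Delta:=s(0,\ell)$, which equals $s(i,\ell)$ for every $i$ in $G(m,\ell)$. An element $\rho\in G(m,\ell)$ is $(p,q)$-periodic if $\rho^p=\Delta^q$. *)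

(* Defs.v *)
From HB Require Import structures.
From mathcomp Require Import all_boot ssralg ssrint.
From mathcomp Require Import generic_quotient boolp.

Set Implicit Arguments.
Unset Strict Implicit.
Unset Printing Implicit Defensive.

Local Open Scope group_scope.
Local Open Scope quotient_scope.

(* MathComp has integer powers in unit rings only. *)
Definition zexpg (G : groupType) (x : G) (z : int) : G :=
  match z with Posz n => x ^+ n | Negz n => x ^- n.+1 end.

(* The letter (x, false) stands for x and (x, true) for its inverse. *)
Definition sword (X : Type) := seq (X * bool).

Definition sword_inv (X : Type) (w : sword X) : sword X :=
  rev [seq (y.1, ~~ y.2) | y <- w].

Definition pos_sword (X : Type) (s : seq X) : sword X :=
  [seq (x, false) | x <- s].

Inductive pres_eq (X : Type) (R : sword X -> sword X -> Prop) :
    sword X -> sword X -> Prop :=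
| pres_refl u : pres_eq R u u
| pres_sym u v : pres_eq R u v -> pres_eq R v u
| pres_trans u v w : pres_eq R u v -> pres_eq R v w -> pres_eq R u w
| pres_cat u u' v v' :
    pres_eq R u u' -> pres_eq R v v' -> pres_eq R (u ++ v) (u' ++ v')
| pres_cancel x b : pres_eq R [:: (x, b); (x, ~~ b)] [::]
| pres_rel u v : R u v -> pres_eq R u v.

Section Presentation.

Variables (X : choiceType) (R : sword X -> sword X -> Prop).

Definition pres_eqb : rel (sword X) := fun u v => `[< pres_eq R u v >].

Lemma pres_eqb_refl : reflexive pres_eqb.
Proof. by move=> u; apply/asboolP; exact: pres_refl. Qed.

Lemma pres_eqb_sym : symmetric pres_eqb.
Proof. by move=> u v; apply/asboolP/asboolP => /pres_sym. Qed.

Lemma pres_eqb_trans : transitive pres_eqb.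
Proof.
move=> v u w /asboolP uv /asboolP vw; apply/asboolP; exact: pres_trans uv vw.
Qed.

Canonical pres_equiv :=
  EquivRel pres_eqb pres_eqb_refl pres_eqb_sym pres_eqb_trans.

(* The group < X | u = v for all u, v with R u v >. *)
Definition presented := {eq_quot pres_equiv}.

HB.instance Definition _ := Choice.copy presented {eq_quot pres_equiv}.

Definition pclass (w : sword X) : presented := \pi_{eq_quot pres_equiv} w.
Definition prepr (g : presented) : sword X := repr (g : {eq_quot pres_equiv}).

Lemma pclassP u v : pclass u = pclass v <-> pres_eq R u v.
Proof.
split=> [/eqmodP/asboolP //|uv]; apply/eqmodP; exact/asboolP.
Qed.

Lemma preprK g : pclass (prepr g) = g.
Proof. exact: reprK. Qed.

Lemma prepr_class w : pres_eq R (prepr (pclass w)) w.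
Proof. by apply/pclassP; rewrite preprK. Qed.

Lemma sword_invK : involutive (@sword_inv X).
Proof.
move=> w; rewrite /sword_inv map_rev revK -map_comp -[RHS]map_id.
by apply: eq_map => -[x b] /=; rewrite negbK.
Qed.

Lemma pres_catV w : pres_eq R (w ++ sword_inv w) [::].
Proof.
elim: w => [|[x b] w IHw]; first exact: pres_refl.
rewrite /sword_inv /= rev_cons -cats1 -/(sword_inv w) catA -cat_cons.
apply: pres_trans (pres_cancel R x b).
apply: (@pres_cat _ _ _ [:: (x, b)] _ [:: (x, ~~ b)]); last exact: pres_refl.
exact: (@pres_cat _ _ [:: (x, b)] [:: (x, b)] _ [::] (pres_refl _ _) IHw).
Qed.

Lemma pres_Vcat w : pres_eq R (sword_inv w ++ w) [::].
Proof. by rewrite -{2}[w]sword_invK; exact: pres_catV. Qed.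

Lemma pres_eq_inv u v : pres_eq R u v -> pres_eq R (sword_inv u) (sword_inv v).
Proof.
move=> uv; rewrite -[X in pres_eq R X _]cats0.
apply: pres_trans (pres_cat (pres_refl R _) (pres_sym (pres_catV v))) _.
rewrite catA -[X in pres_eq R _ X]cat0s; apply: pres_cat; last exact: pres_refl.
apply: pres_trans (pres_Vcat u); apply: pres_cat (pres_refl _ _) (pres_sym uv).
Qed.

Definition pres_mul (g h : presented) : presented :=
  pclass (prepr g ++ prepr h).
Definition pres_one : presented := pclass [::].
Definition pres_inv (g : presented) : presented := pclass (sword_inv (prepr g)).

Lemma pres_mulE u v : pres_mul (pclass u) (pclass v) = pclass (u ++ v).
Proof. by apply/pclassP; apply: pres_cat; exact: prepr_class. Qed.

Lemma pres_invE u : pres_inv (pclass u) = pclass (sword_inv u).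
Proof. by apply/pclassP/pres_eq_inv/prepr_class. Qed.

Fact pres_mulA : associative pres_mul.
Proof.
move=> f g h; rewrite -[f]preprK -[g]preprK -[h]preprK.
by rewrite !pres_mulE catA.
Qed.

Fact pres_mul1g : left_id pres_one pres_mul.
Proof. by move=> g; rewrite -[g]preprK pres_mulE. Qed.

Fact pres_mulg1 : right_id pres_one pres_mul.
Proof. by move=> g; rewrite -[g]preprK pres_mulE cats0. Qed.

Fact pres_mulVg : left_inverse pres_one pres_inv pres_mul.
Proof.
move=> g; rewrite -[g]preprK pres_invE pres_mulE.
by apply/pclassP/pres_Vcat.
Qed.

Fact pres_mulgV : right_inverse pres_one pres_inv pres_mul.
Proof.
move=> g; rewrite -[g]preprK pres_invE pres_mulE.
by apply/pclassP/pres_catV.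
Qed.

HB.instance Definition _ := isGroup.Build presented
  pres_mulA pres_mul1g pres_mulg1 pres_mulVg pres_mulgV.

Definition pgen (x : X) : presented := pclass [:: (x, false)].

Lemma pclass_cat u v : pclass (u ++ v) = pclass u * pclass v.
Proof. by rewrite -pres_mulE. Qed.

Lemma pclass_inv w : pclass (sword_inv w) = (pclass w)^-1.
Proof. by rewrite -pres_invE. Qed.

Lemma pclass_prod w :
  pclass w = \prod_(y <- w) (if y.2 then (pgen y.1)^-1 else pgen y.1).
Proof.
elim: w => [|[x b] w IHw]; first by rewrite big_nil.
rewrite big_cons -IHw -cat1s pclass_cat; congr (_ * _).
by case: b => //=; rewrite -pclass_inv.
Qed.

Lemma presented_univ (H : groupType) (f : X -> H) :
  let ev (w : sword X) := \prod_(y <- w) (if y.2 then (f y.1)^-1 else f y.1) in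
  (forall u v, R u v -> ev u = ev v) ->
  exists phi : presented -> H,
    [/\ {morph phi : g h / g * h}, forall x, phi (pgen x) = f x &
        forall psi : presented -> H, {morph psi : g h / g * h} ->
          (forall x, psi (pgen x) = f x) -> psi =1 phi].
Proof.
move=> ev fR.
have evP u v : pres_eq R u v -> ev u = ev v.
  elim=> {u v} // [u v w _ -> _ -> //|u u' v v' _ eu _ ev'|x b].
  - by rewrite /ev !big_cat -/(ev u) -/(ev v) eu ev'.
  - by rewrite /ev !big_cons !big_nil; case: b; rewrite /= mulg1 ?mulVg ?mulgV.
have evE w : ev (prepr (pclass w)) = ev w by apply/evP/prepr_class.
exists (fun g => ev (prepr g)); split=> [g h|x|psi psiM psi_gen g].
- by rewrite evE /ev big_cat.
- by rewrite evE /ev big_cons big_nil mulg1.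
have psi1 : psi 1 = 1 by apply: (mulgI (psi 1)); rewrite -psiM !mulg1.
have psiV h : psi h^-1 = (psi h)^-1.
  by apply: (mulgI (psi h)); rewrite -psiM !mulgV.
rewrite -{1}[g]preprK pclass_prod (big_morph psi psiM psi1).
by apply: eq_bigr => -[x []] _ /=; rewrite ?psiV psi_gen.
Qed.

End Presentation.

(* [ordS] is the successor modulo m on 'I_m, so [cyc_seq i p] lists
   i, i+1, ..., i+p-1 modulo m. *)
Definition cyc_seq (m : nat) (i : 'I_m) (p : nat) : seq 'I_m :=
  traject (@ordS m) i p.

Lemma size_cyc_seq (m : nat) (i : 'I_m) (p : nat) : size (cyc_seq i p) = p.
Proof. exact: size_traject. Qed.

Lemma nth_cyc_seq (m : nat) (i j : 'I_m) (p k : nat) :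
  (k < p)%N -> nth j (cyc_seq i p) k = (i + k) %% m :> nat.
Proof.
move=> ltkp; rewrite (set_nth_default i) ?size_cyc_seq // nth_traject //; elim: k {ltkp} => [|k IHk] /=.
  by rewrite addn0 modn_small.
by rewrite IHk -addn1 modnDml addn1 addnS.
Qed.

Definition circular_rel (m l : nat) (u v : sword 'I_m) : Prop :=
  exists i : 'I_m,
    u = pos_sword (cyc_seq i l) /\ v = pos_sword (cyc_seq (ordS i) l).

Definition circular_group (m l : nat) : groupType :=
  presented (@circular_rel m l).

Definition circ_gen (m l : nat) (i : 'I_m) : circular_group m l :=
  pgen (@circular_rel m l) i.

Definition circ_s (m l : nat) (i : 'I_m) (p : nat) : circular_group m l :=
  \prod_(j <- cyc_seq i p) circ_gen l j.

Definition garside (m l : nat) (m_gt0 : (0 < m)%N) : circular_group m l :=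
  circ_s l (Ordinal m_gt0) l.

Definition periodic (m l : nat) (m_gt0 : (0 < m)%N) (p q : int)
    (rho : circular_group m l) : Prop :=
  zexpg rho p = zexpg (garside l m_gt0) q.

Lemma circ_sE (m l : nat) (i : 'I_m) (p : nat) :
  circ_s l i p = pclass (@circular_rel m l) (pos_sword (cyc_seq i p)).
Proof. by rewrite pclass_prod big_map. Qed.

Lemma circ_s_ordS (m l : nat) (i : 'I_m) :
  circ_s l i l = circ_s l (ordS i) l.
Proof. by rewrite !circ_sE; apply/pclassP/pres_rel; exists i. Qed.

(* Main.v *)
Require Import Defs.
From mathcomp Require Import all_boot ssralg ssrint.
From mathcomp Require Import boolp zify.

Set Implicit Arguments.
Unset Strict Implicit.
Unset Printing Implicit Defensive.

Local Open Scope group_scope.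

(** Why periodic elements are conjugate.

    Adjoin to G(m, l) an element t of order m with t^-1 a_i t = a_(i+1), and
    put x = a_0 t^-1.  The result is generated by x and t, subject to t^m = 1
    and to x^l being central; in it s(i, n) = t^-i x^n t^(n+i), and modulo x^l
    it is the free product of Z/l and Z/m.  An element of G(m, l)
    some nonzero power of which is a power of the Garside element D has finite
    order in that free product, so it is conjugate to a power of x or of t up to
    a power of x^l.  Back in G(m, l) this says that it is conjugate to a power
    of D or of s(0, m), in other words to an s(0, n) if n is allowed to be
    negative.
    Counting letters, rho^p = D^q forces p n = q l, so p and q determine the
    conjugacy class.

    The proof works inside G(m, l).  As D^m is central and a large power of it
    turns every element into a positive one ([positive_multiple]), it suffices
    to treat products a_(b 0) ... a_(b (N-1)) D^k.  Moving D to the right shifts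
    indices ([garside_letter]), so conjugation by letters slides the window of
    length N along one infinite word ([conj_rotate]).
    - If the infinite word has l consecutive indices somewhere, slide there.
      When N >= l these letters form a D, and N decreases.  When N < l the whole
      window is a run and the element is an s(i, n) with m dividing n, hence
      conjugate to s(0, n).
    - If there are no such letters, the powers of the element act on the normal
      forms of the free product by building longer and longer words
      ([tree_act_no_run]), whereas powers of D add no syllable
      ([tree_act_garside]); the element is not periodic.
    This is [conj_run].  The exponent n is then read off from the length
    homomorphism ([run_expg_inj]). *)

(** * Actions of a presented group *)

Section PresentedAction.

Variables (X : choiceType) (R : sword X -> sword X -> Prop) (S : Type).
Variable f : X * bool -> S -> S.

Definition word_act (w : sword X) (s : S) : S := foldr f s w.

Definition presented_act (g : presented R) (s : S) : S :=
  word_act (prepr g) s.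

Hypothesis fK : forall x b s, f (x, b) (f (x, ~~ b) s) = s.
Hypothesis fR : forall u v, R u v -> word_act u =1 word_act v.

Lemma word_act_pres_eq u v : pres_eq R u v -> word_act u =1 word_act v.
Proof.
elim=> {u v}
  [//|u v _ uv s|u v w _ uv _ vw s|u u' v v' _ uu' _ vv' s|x b s|//].
- by rewrite uv.
- by rewrite uv vw.
- by rewrite /word_act !foldr_cat -!/(word_act _ _) vv' uu'.
- exact: fK.
Qed.

Lemma presented_act_class w : presented_act (pclass R w) =1 word_act w.
Proof. by move=> s; apply/word_act_pres_eq/prepr_class. Qed.

Lemma presented_act1 s : presented_act 1 s = s.
Proof. exact: presented_act_class. Qed.

Lemma presented_actM g h s :
  presented_act (g * h) s = presented_act g (presented_act h s).
Proof.
rewrite -[g]preprK -[h]preprK -pclass_cat !presented_act_class.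
by rewrite /word_act foldr_cat.
Qed.

Lemma presented_act_gen x s : presented_act (pgen R x) s = f (x, false) s.
Proof. exact: presented_act_class. Qed.

End PresentedAction.

(** * The free product of Z/l and Z/m acting on its normal forms *)

(** The action of the n-th power of a generator of Z/m on a state.  A state
    (r, v) is a reduced word whose first syllable is the r-th power of the
    generator, r = 0 included, and whose other syllables, alternately in the two
    factors, have the exponents v; these are nonzero, and are stored minus one.
    Values of r outside the range 0, ..., m - 1 are fixed, which makes the n-th
    turn a bijection without any range condition on states. *)
Definition turn (m n : nat) (s : nat * seq nat) : nat * seq nat :=
  (if s.1 < m then (s.1 + n) %% m else s.1, s.2).

Arguments turn : simpl never.

Lemma turnD m n1 n2 s : turn m n1 (turn m n2 s) = turn m (n2 + n1) s.
Proof.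
rewrite /turn; congr (_, _); rewrite [_.1]/=; case: (ltnP s.1 m) => [lts|les].
  by rewrite ltn_pmod ?(leq_ltn_trans _ lts) // modnDml addnA.
by rewrite ltnNge les.
Qed.

Lemma turn_mod m n1 n2 : n1 = n2 %[mod m] -> turn m n1 =1 turn m n2.
Proof.
move=> en s; rewrite /turn; congr (_, _); case: ifP => // _.
by rewrite -modnDmr en modnDmr.
Qed.

Lemma turn0 m n s : m %| n -> turn m n s = s.
Proof.
move=> /dvdnP[k ->]; case: s => r v; rewrite /turn /=; congr (_, _).
by case: ifP => // lt_r; rewrite addnC modnMDl modn_small.
Qed.

(** The change of point of view between the two factors: a state read as
    starting with a possibly trivial syllable in one factor is read as starting
    with a possibly trivial syllable in the other one.  Storing exponents minus
    one makes this an involution of all states. *)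
Definition flip (s : nat * seq nat) : nat * seq nat :=
  match s with
  | (0, [::]) => (0, [::])
  | (0, e :: v) => (e.+1, v)
  | (i.+1, v) => (0, i :: v)
  end.

Lemma flipK : involutive flip.
Proof. by move=> [[|i] [|e v]]. Qed.

(** The action of the other factor. *)
Definition twist (l n : nat) (s : nat * seq nat) := flip (turn l n (flip s)).

Arguments twist : simpl never.

Lemma twistD l n1 n2 s : twist l n1 (twist l n2 s) = twist l (n2 + n1) s.
Proof. by rewrite /twist flipK turnD. Qed.

Lemma twist0 l n s : l %| n -> twist l n s = s.
Proof. by move=> dv; rewrite /twist turn0 // flipK. Qed.

(** * The action of the circular group *)

Section Circular.

Variables (m l : nat) (m_gt0 : 0 < m) (l_gt0 : 0 < l).

Local Notation G := (circular_group m l).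
Local Notation D := (garside l m_gt0).

(** The letter a_i acts as t^-i x t^(i+1), where t is the turn modulo m and x
    the twist modulo l; (m - 1) i stands for - i modulo m. *)
Definition letter_act (y : 'I_m * bool) (s : nat * seq nat) :=
  let i : nat := y.1 in
  if y.2 then turn m (m.-1 * i.+1) (twist l l.-1 (turn m i s))
  else turn m (m.-1 * i) (twist l 1 (turn m i.+1 s)).

Lemma letter_actK (x : 'I_m) b s :
  letter_act (x, b) (letter_act (x, ~~ b) s) = s.
Proof.
have dvm k : m %| k + m.-1 * k by rewrite -mulSn prednK // dvdn_mulr.
have dvm' k : m %| m.-1 * k + k by rewrite addnC.
case: b; rewrite /letter_act /= turnD (turn0 _ (dvm' _)) twistD.
  by rewrite add1n prednK // twist0 // turnD turn0.
by rewrite addn1 prednK // twist0 // turnD turn0.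
Qed.

(** Consecutive letters telescope to t^-i x^e t^(i+e), since the t^(i+1) of a
    letter cancels the t^-(i+1) of the next one.  For e = l the middle factor
    disappears, and the result depends on i no more. *)
Lemma pos_word_act (i : 'I_m) e s :
  word_act letter_act (pos_sword (cyc_seq i e)) s
  = turn m (m.-1 * i) (twist l e (turn m (i + e) s)).
Proof.
elim: e i => [|e IHe] i.
  rewrite [LHS]/= twist0 // turnD turn0 // addn0 -mulSn prednK //.
  exact: dvdn_mulr.
rewrite [LHS]/= -/(cyc_seq _ _) -/(pos_sword _) -/(word_act _ _ _) IHe.
rewrite /letter_act /= turnD [turn _ _ (twist _ e _)]turn0; last first.
  by rewrite /dvdn -modnDml modnMmr modnDml -mulSnr prednK // modnMr.
rewrite twistD addn1; congr (turn _ _ (twist _ _ _)); apply: turn_mod.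
by rewrite modnDml addSnnS.
Qed.

Lemma letter_act_rel u v : circular_rel l u v ->
  word_act letter_act u =1 word_act letter_act v.
Proof.
move=> [i [-> ->]] s; rewrite !pos_word_act !twist0 // !turnD.
apply: turn_mod; rewrite addnAC -mulSn prednK // addnAC -mulSn prednK //.
by rewrite ![(m * _)%N]mulnC !modnMDl.
Qed.

(** * Runs of consecutive letters and the Garside element *)

Definition letter (n : nat) : G := circ_gen l (Ordinal (ltn_pmod n m_gt0)).

Lemma letter_mod n1 n2 : n1 = n2 %[mod m] -> letter n1 = letter n2.
Proof. by move=> en; congr (circ_gen l _); apply: val_inj. Qed.

Lemma circ_gen_letter (i : 'I_m) : circ_gen l i = letter i.
Proof. by congr (circ_gen l _); apply: val_inj; rewrite /= modn_small. Qed.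

Definition run (i n : nat) : G := \prod_(i <= j < i + n) letter j.

Lemma runS i n : run i n.+1 = letter i * run i.+1 n.
Proof. by rewrite /run big_ltn ?addSnnS //; lia. Qed.

Lemma runD i n1 n2 : run i (n1 + n2) = run i n1 * run (i + n1) n2.
Proof. by rewrite /run (big_cat_nat (n := i + n1)) ?addnA //=; lia. Qed.

Lemma circ_s_run (i : 'I_m) n : circ_s l i n = run i n.
Proof.
suff E j : i = j %[mod m] -> circ_s l i n = run j n by exact: E.
elim: n i j => [|n IHn] i j eij.
  by rewrite /circ_s /run big_nil addn0 big_geq.
rewrite /circ_s /cyc_seq /= big_cons -/(cyc_seq _ _) -/(circ_s _ _ _) runS.
rewrite circ_gen_letter (letter_mod eij) (IHn _ j.+1) //=.
by rewrite modn_mod -addn1 -modnDml eij modnDml addn1.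
Qed.

Lemma run_mod i j n : i = j %[mod m] -> run i n = run j n.
Proof.
move=> eij; elim: n i j eij => [|n IHn] i j eij.
  by rewrite /run !addn0 !big_geq.
rewrite !runS (letter_mod eij) (IHn _ j.+1) //.
by rewrite -addn1 -modnDml eij modnDml addn1.
Qed.

Lemma run_garside i : run i l = D.
Proof.
have <- : run 0 l = D by rewrite /garside circ_s_run.
elim: i => // i <-; pose o := Ordinal (ltn_pmod i m_gt0).
have := circ_s_ordS l o; rewrite !circ_s_run /=.
rewrite (@run_mod (i %% m) i) ?modn_mod // => ->.
by apply: run_mod; rewrite modn_mod -(addn1 (i %% m)) modnDml addn1.
Qed.

(** Both sides are s(n, l + 1), split after the first or before the last
    letter. *)
Lemma letter_garside n : letter n * D = D * letter (n + l).
Proof.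
rewrite -{1}(run_garside n.+1) -runS -addn1 runD run_garside.
by rewrite /run addn1 big_nat1.
Qed.

Lemma run_garsideX i n k : run i n * D ^+ k = run i (n + k * l).
Proof.
elim: k => [|k IHk]; first by rewrite mulg1 addn0.
by rewrite expgSr mulgA IHk mulSnr addnA [RHS]runD run_garside.
Qed.

(** Since indices matter modulo m only, the shift by - l can be written as the
    shift by l (m - 1). *)
Lemma garside_letter n : D * letter n = letter (n + l * m.-1) * D.
Proof.
rewrite letter_garside; congr (_ * _); apply: letter_mod.
by rewrite -addnA -mulnSr prednK // addnC modnMDl.
Qed.

Lemma garsideX_prod k (r : seq nat) (F : nat -> nat) :
  D ^+ k * \prod_(j <- r) letter (F j)
  = (\prod_(j <- r) letter (F j + k * (l * m.-1))) * D ^+ k.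
Proof.
elim: r => [|j r IHr]; first by rewrite !big_nil mulg1 mul1g.
rewrite !big_cons -mulgA -IHr !mulgA; congr (_ * _).
elim: k {r IHr} => [|k IHk]; first by rewrite mulg1 mul1g addn0.
by rewrite expgS -mulgA IHk mulgA garside_letter -mulgA mulSnr addnA.
Qed.

Lemma garside_central k g : commute (D ^+ (m * k)) g.
Proof.
suff c n : commute (D ^+ (m * k)) (letter n).
  rewrite -[g]preprK pclass_prod; apply: commute_prod => -[x b] _ /=.
  rewrite -/(circ_gen l x) circ_gen_letter.
  by case: b => //; apply: commuteV.
have := garsideX_prod (m * k) [:: n] id; rewrite !big_seq1 /commute => ->.
congr (_ * _); apply: letter_mod.
by rewrite -mulnA addnC mulnC modnMDl.
Qed.

(** The inverse of a_i is s(i + 1, m l - 1) up to the central factor D^m. *)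
Lemma positive_multiple g :
  exists N r, g * D ^+ (m * N) = \prod_(j <- r) letter j.
Proof.
rewrite -[g]preprK; elim: (prepr g) => [|[x b] w [N [r IHw]]].
  by exists 0, [::]; rewrite muln0 mulg1 big_nil.
rewrite -cat1s pclass_cat; case: b; last first.
  exists N, ((x : nat) :: r); rewrite -mulgA IHw big_cons; congr (_ * _).
  by rewrite -circ_gen_letter.
have -> : pclass (circular_rel l) [:: (x, true)] = (letter x)^-1.
  by rewrite -circ_gen_letter /circ_gen /pgen -pclass_inv.
have invE : (letter x)^-1 * D ^+ m = run x.+1 (m * l).-1.
  apply: (canLR (mulKg _)); rewrite -runS prednK ?muln_gt0 ?m_gt0 //.
  by rewrite -[RHS](run_garsideX x 0) /run addn0 big_geq // mul1g.
exists N.+1, (index_iota x.+1 (x.+1 + (m * l).-1) ++ r).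
have cm := garside_central 1 (pclass (circular_rel l) w); rewrite muln1 in cm.
rewrite -mulgA mulnS expgnDr [X in _ * X = _]mulgA -cm -mulgA IHw mulgA invE.
by rewrite big_cat.
Qed.

(** * Words without a run of length l *)

Definition tree_act (g : G) := presented_act letter_act g.

Lemma tree_actM g h s : tree_act (g * h) s = tree_act g (tree_act h s).
Proof. exact: presented_actM letter_actK letter_act_rel g h s. Qed.

Lemma tree_act_letter n s :
  tree_act (letter n) s = turn m (m.-1 * n) (twist l 1 (turn m n.+1 s)).
Proof.
rewrite [LHS](presented_act_gen letter_actK letter_act_rel) /letter_act /=.
have -> : turn m (n %% m).+1 s = turn m n.+1 s.
  by apply: turn_mod; rewrite -addn1 modnDml addn1.
by apply: turn_mod; rewrite modnMmr.
Qed.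

Lemma tree_act_garside k s : (tree_act (D ^+ k) s).2 = s.2.
Proof.
elim: k => [|k IHk].
  by rewrite [tree_act _ _](presented_act1 letter_actK letter_act_rel).
rewrite expgS tree_actM -[RHS]IHk; move: (tree_act _ s) => {k IHk}s.
rewrite /garside circ_sE.
rewrite [tree_act _ _](presented_act_class letter_actK letter_act_rel).
by rewrite pos_word_act twist0.
Qed.

Section Growth.

Variable b : nat -> nat.
Hypothesis no_run :
  forall t, ~ forall i, i < l -> b (t + i) = b t + i %[mod m].

Lemma no_run_l_gt1 : 1 < l.
Proof.
rewrite ltn_neqAle l_gt0 andbT; apply/eqP => l1.
case: (no_run (t := 0)) => i; rewrite -l1 ltnS leqn0.
by move=> /eqP->; rewrite !addn0.
Qed.

(** A letter that does not extend the run on its right opens a new syllable, in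
    front of v or of the syllable left by the turn. *)
Lemma tree_act_push n s r v : turn m n.+1 s = (r, v) -> 0 < r \/ v = [::] ->
  exists v', tree_act (letter n) s = ((m.-1 * n) %% m, 0 :: v').
Proof.
move=> Es rv; rewrite tree_act_letter Es /twist.
have [v' ->] : exists v', flip (r, v) = (0, v').
  case: r v rv {Es} => [|r] v [] // => [->|_|_]; first by exists [::].
    by exists (r :: v).
  by exists (r :: v).
exists v'; rewrite /turn /= l_gt0 add0n modn_small ?no_run_l_gt1 //=.
by rewrite m_gt0.
Qed.

(** A letter that extends the run on its right increases the exponent of the
    first syllable.  The bound on e says that this exponent does not reach l,
    where the syllable would vanish. *)
Lemma tree_act_grow n s e v : turn m n.+1 s = (0, e :: v) -> e.+2 < l ->
  tree_act (letter n) s = ((m.-1 * n) %% m, e.+1 :: v).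
Proof.
move=> Es lt_e; rewrite tree_act_letter Es /twist /turn /=.
by rewrite (ltnW lt_e) addn1 modn_small //= m_gt0.
Qed.

(** The first syllable of the state has the length of the run at the front of
    the word as exponent; without runs of length l no syllable ever vanishes. *)
Lemma tree_act_no_run d t r : exists e v,
  [/\ tree_act (\prod_(t <= n < t + d.+1) letter (b n)) (r, [::])
        = ((m.-1 * b t) %% m, e :: v)
    , e.+1 < l
    & forall i, i < e.+1 -> b (t + i) = b t + i %[mod m] ].
Proof.
elim: d t => [|d IHd] t.
  rewrite addn1 big_nat1.
  have [|v' ->] := tree_act_push (n := b t) (s := (r, [::])) (erefl _).
    by right.
  exists 0, v'; split=> //; first exact: no_run_l_gt1.
  by move=> i; rewrite ltnS leqn0 => /eqP->; rewrite !addn0.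
have [e [v [Es lt_e Eb]]] := IHd t.+1.
rewrite big_ltn; last by rewrite addnS ltnS leq_addr.
rewrite -[t + d.+2]addSnnS tree_actM Es.
set s := (X in tree_act _ X).
have Et : turn m (b t).+1 s = ((m.-1 * b t.+1 + (b t).+1) %% m, e :: v).
  by rewrite /turn /= ltn_pmod // modnDml.
have [r0|r_gt0] := posnP ((m.-1 * b t.+1 + (b t).+1) %% m); last first.
  have [|v' ->] := tree_act_push Et; first by left.
  exists 0, v'; split=> //; first exact: no_run_l_gt1.
  by move=> i; rewrite ltnS leqn0 => /eqP->; rewrite !addn0.
have Ebt : b t.+1 = (b t).+1 %[mod m].
  have : b t.+1 + (m.-1 * b t.+1 + (b t).+1) = b t.+1 %[mod m].
    by rewrite -modnDmr r0 addn0.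
  by rewrite addnA -mulSn prednK // mulnC modnMDl.
have Eb' i : i < e.+2 -> b (t + i) = b t + i %[mod m].
  case: i => [|i]; first by rewrite !addn0.
  rewrite ltnS => /Eb; rewrite addSnnS => ->.
  by rewrite -modnDml Ebt modnDml addSnnS.
have lt_e2 : e.+2 < l.
  rewrite ltn_neqAle lt_e andbT; apply/eqP => le.
  by case: (no_run (t := t)) => i; rewrite -le; exact: Eb'.
by rewrite r0 in Et; exists e.+1, v; rewrite (tree_act_grow Et).
Qed.

End Growth.

(** * Conjugating a periodic element to a run *)

Lemma prod_shift (F : nat -> G) t N :
  \prod_(t <= n < t + N) F n = \prod_(0 <= n < N) F (t + n).
Proof.
rewrite -{1}[t]add0n big_addn addKn.
by apply: eq_bigr => n _; rewrite addnC.
Qed.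

(** Both s(0, i) s(i, n) and s(0, n) s(n, i) are s(0, n + i), and s(n, i) is
    s(0, i) when m divides n. *)
Lemma run_conj i n : m %| n -> exists g, run i n ^ g = run 0 n.
Proof.
move=> m_n; exists (run 0 i)^-1; rewrite /conjg invgK mulgA -runD addnC runD.
by rewrite add0n (@run_mod n 0) ?mulgK // mod0n; apply/eqP.
Qed.

(** Conjugation by the first letter of the window moves that letter to the right
    of D^k; taking it back to the left of D^k shifts its index, which gives the
    next letter of the infinite word b. *)
Lemma conj_rotate (b : nat -> nat) N k t :
    (forall n, b (n + N) = b n + k * (l * m.-1)) ->
  exists g, ((\prod_(0 <= n < N) letter (b n)) * D ^+ k) ^ g
            = (\prod_(t <= n < t + N) letter (b n)) * D ^+ k.
Proof.
move=> bN; elim: t => [|t [g IHt]]; first by exists 1; rewrite conjg1.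
exists (g * letter (b t)); rewrite conjgM IHt /conjg -mulgA.
have := garsideX_prod k [:: t] b; rewrite !big_seq1 => ->; rewrite -bN.
rewrite [X in _ * X]mulgA -big_nat_recr ?leq_addr //=.
by rewrite big_ltn ?ltnS ?leq_addr // -mulgA mulKg addSn.
Qed.

Lemma prod_garside_expg (b : nat -> nat) N k P :
    (forall n, b (n + N) = b n + k * (l * m.-1)) ->
  ((\prod_(0 <= n < N) letter (b n)) * D ^+ k) ^+ P
  = (\prod_(0 <= n < N * P) letter (b n)) * D ^+ (k * P).
Proof.
move=> bN; have bNP P' n : b (n + N * P') = b n + k * P' * (l * m.-1).
  elim: P' => [|P' IHP]; first by rewrite !muln0 mul0n !addn0.
  by rewrite mulnS (addnC N) addnA bN IHP mulnS mulnDl -!addnA [k * _ + _]addnC.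
elim: P => [|P IHP]; first by rewrite expg0 !muln0 big_geq // mulg1.
rewrite expgSr IHP -mulgA [X in _ * X]mulgA garsideX_prod.
rewrite -[X in _ * X]mulgA -expgnDr (mulnS k) (addnC k) mulgA; congr (_ * _).
rewrite mulnS addnC [RHS](big_cat_nat (n := (N * P)%N)) ?leq_addr //=.
rewrite (prod_shift _ (N * P)%N); congr (_ * _); apply: eq_bigr => n _.
by rewrite [(_ + n)%N]addnC bNP.
Qed.

(** The exponent of D is a multiple of m so that the right-hand side is central:
    the hypothesis then passes to conjugates, as the induction on N requires. *)
Lemma conj_run N (b : nat -> nat) k P Q : 0 < P ->
    ((\prod_(0 <= n < N) letter (b n)) * D ^+ k) ^+ P = D ^+ (m * Q) ->
  exists n g, ((\prod_(0 <= n < N) letter (b n)) * D ^+ k) ^ g = run 0 n.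
Proof.
move=> P_gt0; elim/ltn_ind: N b k => N IHN b0 k.
have [->|N_gt0] := posnP N.
  move=> _; exists (k * l)%N, 1.
  by rewrite conjg1 -[(k * l)%N]add0n -run_garsideX /run !big_geq.
(* the infinite word in which the windows of length N are conjugate *)
have [b bN ->] : exists2 b : nat -> nat,
    forall n, b (n + N) = b n + k * (l * m.-1) &
    \prod_(0 <= n < N) letter (b0 n) = \prod_(0 <= n < N) letter (b n).
  exists (fun n => b0 (n %% N) + n %/ N * (k * (l * m.-1))) => [n|].
    by rewrite modnDr divnDr // divnn N_gt0 addn1 mulSnr addnA.
  apply: eq_big_nat => n /andP[_ ltnN].
  by rewrite modn_small // divn_small // mul0n addn0.
move=> eP.
have [[t run_t]|no_run] :=
  EM (exists t, forall i, i < l -> b (t + i) = b t + i %[mod m]).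
  have [g rot] := conj_rotate t bN.
  case: (ltnP N l) => [ltNl|leNl].
    have wE : \prod_(t <= n < t + N) letter (b n) = run (b t) N.
      rewrite /run (prod_shift _ t) (prod_shift _ (b t)).
      apply: eq_big_nat => n /andP[_ ltnN].
      by apply/letter_mod/run_t/(ltn_trans ltnN).
    (* as N < l, the run also covers the first letter after the window, so that
       the shift between successive windows is N modulo m *)
    have [|h hE] := @run_conj (b t) (N + k * l).
      have := run_t N ltNl; rewrite bN => /eqP; rewrite eqn_modDl => /eqP eN.
      rewrite /dvdn -modnDml -eN modnDml mulnA -mulnSr prednK //.
      by rewrite modnMl.
    by exists (N + k * l)%N, (g * h); rewrite conjgM rot wE run_garsideX.
  have rE : \prod_(t <= n < t + N) letter (b n) * D ^+ k
            = (\prod_(0 <= n < N - l)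
                 letter (b (n + (t + l)) + 1 * (l * m.-1))) * D ^+ k.+1.
    rewrite (big_cat_nat (n := t + l)) ?leq_addr ?leq_add2l //=.
    rewrite expgS mulgA -(@garsideX_prod 1) -(run_garside (b t)).
    congr (_ * _ * _).
      rewrite /run (prod_shift _ t) (prod_shift _ (b t)).
      apply: eq_big_nat => n /andP[_ ltnl].
      exact/letter_mod/run_t.
    have -> : t + N = t + l + (N - l) by rewrite -addnA subnKC.
    by rewrite (prod_shift _ (t + l)); apply: eq_bigr => n _; rewrite addnC.
  have ltN : N - l < N by rewrite ltn_subrL l_gt0.
  have [|n [h hE]] :=
    IHN _ ltN (fun n => b (n + (t + l)) + 1 * (l * m.-1)) k.+1.
    by rewrite -rE -rot -conjXg eP /conjg garside_central mulKg.
  by exists n, (g * h); rewrite conjgM rot rE.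
have := congr1 (fun g => (tree_act g (0, [::])).2) eP.
rewrite /= (prod_garside_expg _ bN) tree_act_garside tree_actM.
case: (tree_act _ (0, [::])) (tree_act_garside (k * P) (0, [::])) => r _ /= ->.
have [t rt|e [v [E _ _]]] := @tree_act_no_run b _ (N * P).-1 0 r.
  by case: no_run; exists t.
by rewrite add0n prednK ?muln_gt0 ?N_gt0 // in E; rewrite E.
Qed.

(** * The length homomorphism *)

(** The homomorphism to the integers that sends every letter to 1, realized by
    translations. *)
Definition length_act (y : 'I_m * bool) (z : int) : int :=
  (if y.2 then z - 1 else z + 1)%R.

Lemma length_actK (x : 'I_m) b z :
  length_act (x, b) (length_act (x, ~~ b) z) = z.
Proof. by case: b; rewrite /length_act /= ?GRing.addrK ?GRing.subrK. Qed.

Lemma length_act_pos (r : seq 'I_m) z :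
  word_act length_act (pos_sword r) z = (z + (size r)%:Z)%R.
Proof.
elim: r => [|x r IHr]; first by rewrite GRing.addr0.
by rewrite /= -/(word_act _ _ _) IHr /length_act /=; lia.
Qed.

Lemma length_act_rel u v : circular_rel l u v ->
  word_act length_act u =1 word_act length_act v.
Proof. by move=> [i [-> ->]] z; rewrite !length_act_pos !size_cyc_seq. Qed.

Lemma run_expg_inj n1 n2 P :
  0 < P -> run 0 n1 ^+ P = run 0 n2 ^+ P -> n1 = n2.
Proof.
move=> P_gt0 eP; pose L (g : G) := presented_act length_act g.
have Lrun n z : L (run 0 n) z = (z + n%:Z)%R.
  rewrite -(circ_s_run (Ordinal m_gt0)) circ_sE.
  rewrite [LHS](presented_act_class length_actK length_act_rel).
  by rewrite length_act_pos size_cyc_seq.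
have LX n : L (run 0 n ^+ P) 0%R = Posz (n * P).
  elim: P {P_gt0 eP} => [|P IHP].
    by rewrite muln0 [LHS](presented_act1 length_actK length_act_rel).
  rewrite expgS [LHS](presented_actM length_actK length_act_rel).
  by rewrite -/(L _ _) -/(L _ _) IHP Lrun mulnS addnC.
have := congr1 (fun g => L g 0%R) eP; rewrite /= !LX => -[] /eqP.
by rewrite eqn_pmul2r // => /eqP.
Qed.

(** * Periodic elements *)

(** Signs of p and q are removed in a way that depends on p and q only, so that
    the outcome can be shared by two periodic elements. *)
Lemma periodic_nat (p q : int) : p <> Posz 0 ->
  exists P M Q : nat, 0 < P /\
    forall rho : G, periodic m_gt0 p q rho -> rho ^+ P * D ^+ M = D ^+ Q.
Proof.
rewrite /periodic; case: p q => [p|p] [q|q] /= p_neq0.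
- exists p, 0, q; split; first by case: p p_neq0.
  by move=> rho ->; rewrite mulg1.
- exists p, q.+1, 0; split; first by case: p p_neq0.
  by move=> rho ->; rewrite mulVg.
- exists p.+1, q, 0; split=> // rho <-.
  by rewrite mulgV.
- exists p.+1, 0, q.+1; split=> // rho /invg_inj ->.
  by rewrite mulg1.
Qed.

(** The central factor D^(m N) makes the element positive and absorbs D^M; the
    factor m in the exponent of the power makes the power central. *)
Lemma periodic_conj_run P M Q N1 r (rho : G) N :
    0 < P -> rho ^+ P * D ^+ M = D ^+ Q ->
    rho * D ^+ (m * N1) = \prod_(j <- r) letter j ->
    N1 + M <= N ->
  exists n g, (rho * D ^+ (m * N)) ^ g = run 0 n
    /\ run 0 n ^+ (P * m) = D ^+ (m * (Q + (m * N * P - M))).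
Proof.
move=> P_gt0 eP er leN.
have eX : (rho * D ^+ (m * N)) ^+ (P * m) = D ^+ (m * (Q + (m * N * P - M))).
  rewrite expgnA [(m * (_ + _))%N]mulnC [RHS]expgnA; congr (_ ^+ _).
  rewrite expgMn; last exact/commute_sym/garside_central.
  rewrite -expgnA [in RHS]expgnDr -eP -mulgA -expgnDr subnKC //.
  apply: leq_trans (leq_trans (leq_addl N1 M) leN) _.
  by rewrite mulnAC leq_pmull ?muln_gt0 ?m_gt0.
have eN : rho * D ^+ (m * N)
          = \prod_(0 <= n < size r) letter (nth 0 r n) * D ^+ (m * (N - N1)).
  rewrite -(big_nth 0 xpredT letter) -er -mulgA -expgnDr -mulnDr subnKC //.
  by apply: leq_trans leN; rewrite leq_addr.
have [| |n [g gE]] := @conj_run (size r) (nth 0 r) (m * (N - N1)) (P * m)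
                      (Q + (m * N * P - M)).
- by rewrite muln_gt0 P_gt0.
- by rewrite -eN eX.
exists n, g; rewrite eN gE; split=> //.
by rewrite -gE -eN -conjXg eX /conjg garside_central mulKg.
Qed.

End Circular.

Theorem proposition2p12 (m l : nat) (m_gt0 : (0 < m)%N) (l_gt0 : (0 < l)%N)
    (p q : int) (p_neq0 : p <> Posz 0) (rho sigma : circular_group m l) :
  periodic m_gt0 p q rho -> periodic m_gt0 p q sigma ->
  exists g : circular_group m l, sigma = rho ^ g.
Proof.
move=> per_rho per_sigma.
have [P [M [Q [P_gt0 perE]]]] := @periodic_nat m l m_gt0 p q p_neq0.
have [N1 [r1 er1]] := positive_multiple m_gt0 l_gt0 rho.
have [N2 [r2 er2]] := positive_multiple m_gt0 l_gt0 sigma.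
pose N := N1 + N2 + M.
have [|n1 [g1 [e1 X1]]] :=
  periodic_conj_run l_gt0 (N := N) P_gt0 (perE _ per_rho) er1; first by lia.
have [|n2 [g2 [e2 X2]]] :=
  periodic_conj_run l_gt0 (N := N) P_gt0 (perE _ per_sigma) er2; first by lia.
have en : n1 = n2.
  have Pm_gt0 : 0 < P * m by rewrite muln_gt0 P_gt0.
  exact: run_expg_inj Pm_gt0 (etrans X1 (esym X2)).
rewrite -{}en -{}e1 {n2 X2 X1 n1} in e2.
have conjD g : (garside l m_gt0 ^+ (m * N)) ^ g = garside l m_gt0 ^+ (m * N).
  by rewrite /conjg garside_central // mulKg.
move: e2; rewrite !conjMg !conjD.
by move=> /mulIg e; exists (g1 / g2); rewrite conjgM -e conjgK.
Qed.
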